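(* Let $p$ be a prime, $r\ge1$, $\alpha_1,\dots,\alpha_r\ge1$ integers, $m\ge1$ an integer, and let $A=\mathbb{Z}_{p^{\alpha_1}}\oplus\cdots\oplus\mathbb{Z}_{p^{\alpha_r}}$ (direct product of rings). Then $\mathsf{D}_m(A)\le U(p^{\alpha_1},\dots,p^{\alpha_r};m)$.
   Context: For a finite commutative ring $A$, a sequence over $A$ is a finite multiset $S=(a_1,\dots,a_\ell)$ of elements of $A$; its length $|S|=\ell$ counts multiplicity, and a subsequence is a sub-multiset. For $m\ge1$, $e_m(S)=\sum_{1\le i_1<\dots<i_m\le \ell}\prod_{j=1}^m a_{i_j}$. $\mathsf{D}_m(A)$ is the smallest positive integer $t$ such that every sequence $S$ over $A$ with $|S|\ge t$ contains a subsequence $S'$ with $|S'|\ge m$ and $e_m(S')=0$. The ring $A$ has componentwise addition and multiplication. $U(p^{\alpha_1},\dots,p^{\alpha_r};m)$ is the smallest integer $t\ge m\sum_{i=1}^r(p^{\alpha_i}-1)+1$ such that $\sum_{0\le 2j\le m-1}\binom{t}{2j}\not\equiv\sum_{1\le 2j+1\le m-1}\binom{t}{2j+1}\pmod p$ (equivalently, such that $\binom{t-1}{m-1}\not\equiv0\pmod p$). *)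

(* Defs.v *)
From HB Require Import structures.
From mathcomp Require Import all_boot all_order all_algebra.
From mathcomp Require Import boolp.

Set Implicit Arguments.
Unset Strict Implicit.
Unset Printing Implicit Defensive.

Import GRing.Theory.
Local Open Scope ring_scope.

(* The direct product of a finite family of finite commutative rings. The     *)
(* library has no ring structure on dependent finite functions; the alias     *)
(* keeps the structure below apart from the group structure that gproduct     *)
(* puts on {dffun _}.                                                         *)
Section RingProduct.
Variables (I : finType) (R : I -> finComPzRingType).

Definition ring_prod : Type := {dffun forall i : I, R i}.

HB.instance Definition _ := Finite.on ring_prod.

Implicit Types x y z : ring_prod.

Definition ring_prod_zero : ring_prod := [ffun i => 0 : R i].
Definition ring_prod_one : ring_prod := [ffun i => 1 : R i].
Definition ring_prod_opp x : ring_prod := [ffun i => - (x i)].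
Definition ring_prod_add x y : ring_prod := [ffun i => x i + y i].
Definition ring_prod_mul x y : ring_prod := [ffun i => x i * y i].

Fact ring_prod_addA : associative ring_prod_add.
Proof. by move=> x y z; apply/ffunP=> i; rewrite !ffunE addrA. Qed.
Fact ring_prod_addC : commutative ring_prod_add.
Proof. by move=> x y; apply/ffunP=> i; rewrite !ffunE addrC. Qed.
Fact ring_prod_add0 : left_id ring_prod_zero ring_prod_add.
Proof. by move=> x; apply/ffunP=> i; rewrite !ffunE add0r. Qed.
Fact ring_prod_addN : left_inverse ring_prod_zero ring_prod_opp ring_prod_add.
Proof. by move=> x; apply/ffunP=> i; rewrite !ffunE addNr. Qed.
Fact ring_prod_mulA : associative ring_prod_mul.
Proof. by move=> x y z; apply/ffunP=> i; rewrite !ffunE mulrA. Qed.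
Fact ring_prod_mulC : commutative ring_prod_mul.
Proof. by move=> x y; apply/ffunP=> i; rewrite !ffunE mulrC. Qed.
Fact ring_prod_mul1 : left_id ring_prod_one ring_prod_mul.
Proof. by move=> x; apply/ffunP=> i; rewrite !ffunE mul1r. Qed.
Fact ring_prod_mulD : left_distributive ring_prod_mul ring_prod_add.
Proof. by move=> x y z; apply/ffunP=> i; rewrite !ffunE mulrDl. Qed.

HB.instance Definition _ := GRing.isZmodule.Build ring_prod
  ring_prod_addA ring_prod_addC ring_prod_add0 ring_prod_addN.
HB.instance Definition _ := GRing.Zmodule_isComPzRing.Build ring_prod
  ring_prod_mulA ring_prod_mulC ring_prod_mul1 ring_prod_mulD.

End RingProduct.

(* Finite sequences up to reordering are represented by lists: every          *)
(* sub-multiset of a list is, up to reordering, one of its subseqs, and       *)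
(* neither the length nor elem_sym depends on the order.                      *)

(* An m-element set of positions stands for i_1 < ... < i_m. *)
Definition elem_sym (A : comPzRingType) (m : nat) (S : seq A) : A :=
  \sum_(I : {set 'I_(size S)} | #|I| == m) \prod_(i in I) S`_i.

Definition Dm_bound (A : finComPzRingType) (m t : nat) : Prop :=
  (0 < t)%N /\
  forall S : seq A, (t <= size S)%N ->
    exists S' : seq A,
      [/\ subseq S' S, (m <= size S')%N & elem_sym m S' = 0].

Lemma card_mulrn (A : finComPzRingType) (x : A) : x *+ #|A| = 0.
Proof.
have addxK : bijective (fun y : A => x + y).
  by exists (fun y => - x + y) => y; rewrite ?addKr ?addNKr.
apply: (addIr (\sum_(y : A) y)).
rewrite add0r [in RHS](reindex _ (onW_bij _ addxK)).
by rewrite big_split /= sumr_const.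
Qed.

Lemma elem_sym_nseq (A : comPzRingType) (m N : nat) (a : A) :
  elem_sym m (nseq N a) = a ^+ m *+ 'C(N, m).
Proof.
rewrite /elem_sym (eq_bigr (fun=> a ^+ m)); last first.
  move=> I /eqP <-; rewrite -prodr_const; apply: eq_bigr => i _.
  by rewrite nth_nseq -[in ltnRHS](size_nseq N a) ltn_ord.
rewrite sumr_const -[in RHS](size_nseq N a) -[in 'C(_, m)](card_ord (size _)).
by rewrite -card_draws cardsE.
Qed.

(* In a long enough list some a occurs m * #|A| times, and then               *)
(* e_m(a, ..., a) is a multiple of #|A|.                                      *)
Lemma Dm_bound_ex (A : finComPzRingType) (m : nat) (m_gt0 : (0 < m)%N) :
  exists t, `[< Dm_bound A m t >].
Proof.
have A_gt0 : (0 < #|A|)%N by apply/card_gt0P; exists 0.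
pose N := (m * #|A|)%N; exists (#|A| * N)%N; apply/asboolP; split.
  by rewrite !muln_gt0 A_gt0 m_gt0.
move=> S leS; have [a leNa] : exists a, (N <= count_mem a S)%N.
  apply/existsP; apply: contraLR leS => /existsPn ltN; rewrite -ltnNge.
  have -> : size S = (\sum_(a : A) count_mem a S)%N.
    elim: S {ltN} => [|b S IHS] /=; first by rewrite big1.
    rewrite big_split /= -IHS (bigD1 b) //= eqxx big1 // => a.
    by rewrite eq_sym => /negPf->.
  rewrite -sum_nat_const.
  apply: leq_trans (_ : (\sum_(a : A) (count_mem a S).+1 <= _)%N).
    under [X in (_ < X)%N]eq_bigr do rewrite -addn1.
    by rewrite big_split /= sum1_card -addn1 leq_add2l.
  by apply: leq_sum => a _; rewrite ltnNge ltN.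
exists (nseq N a); split.
- apply: subseq_trans (_ : subseq [seq x <- S | x == a] S).
    have /all_pred1P -> : all (pred1 a) [seq x <- S | x == a].
      exact: filter_all.
    by rewrite size_filter -(subnKC leNa) nseqD; exact: prefix_subseq.
  exact: filter_subseq.
- by rewrite size_nseq leq_pmulr.
rewrite elem_sym_nseq; have -> : 'C(N, m) = (#|A| * 'C(N.-1, m.-1))%N.
  apply/eqP; rewrite -(eqn_pmul2l m_gt0); apply/eqP.
  by rewrite mulnA -/N -[in LHS](prednK m_gt0) mul_bin_diag.
by rewrite mulrnA card_mulrn mul0rn.
Qed.

Definition Dm (A : finComPzRingType) (m : nat) (m_gt0 : (0 < m)%N) : nat :=
  ex_minn (Dm_bound_ex A m_gt0).
Arguments Dm : clear implicits.

Definition U_cond (p r : nat) (alpha : 'I_r -> nat) (m t : nat) : bool :=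
  (m * (\sum_(i < r) (p ^ alpha i - 1)) + 1 <= t)%N &&
  (\sum_(0 <= k < m | ~~ odd k) 'C(t, k) !=
     \sum_(0 <= k < m | odd k) 'C(t, k) %[mod p])%N.

(* Any large power of p satisfies the condition. *)
Lemma U_cond_ex (p r : nat) (alpha : 'I_r -> nat) (m : nat) :
  prime p -> (0 < m)%N -> exists t, U_cond p alpha m t.
Proof.
move=> p_pr m_gt0; set b := (m * (\sum_(i < r) (p ^ alpha i - 1)) + 1)%N.
have ltp n : (n < p ^ n)%N by rewrite ltn_expl // prime_gt1.
exists (p ^ (b + m))%N; apply/andP; split.
  by apply: leq_trans (ltnW (ltp _)); rewrite leq_addr.
have dvC k : (0 < k < m)%N -> (p %| 'C(p ^ (b + m), k))%N.
  case/andP=> k_gt0 lt_km; have le_k : (k < p ^ (b + m))%N.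
    by apply: leq_trans (ltnW (ltp _)); apply: leq_trans lt_km (leq_addl _ _).
  have := mul_bin_diag (p ^ (b + m)) k.-1; rewrite prednK // => eqC.
  have : (p ^ (b + m) %| k * 'C(p ^ (b + m), k))%N by rewrite -eqC dvdn_mulr.
  apply: contraTT => pC; have cop : coprime (p ^ (b + m)) 'C(p ^ (b + m), k).
    by rewrite coprimeXl // prime_coprime.
  by rewrite Gauss_dvdl // gtnNdvd.
have [/eqP-> /eqP->] :
   (p %| \sum_(0 <= k < m | odd k) 'C(p ^ (b + m), k))%N /\
   (\sum_(0 <= k < m | ~~ odd k) 'C(p ^ (b + m), k) == 1 %[mod p])%N.
  split.
    rewrite big_nat_cond; apply: dvdn_sum => k /andP[/andP[_ ltm] okk].
    by apply: dvC; rewrite ltm odd_gt0.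
  rewrite big_mkcond big_ltn //= bin0 -modnDmr.
  suff /eqP-> : (p %| \sum_(1 <= k < m)
      (if ~~ odd k then 'C(p ^ (b + m), k) else 0))%N.
    by rewrite addn0.
  rewrite big_nat_cond; apply: dvdn_sum => k /andP[ltm _].
  by case: ifP => // _; apply: dvC.
by rewrite modn_small ?prime_gt1.
Qed.

(* The moduli p ^ alpha_i enter only through p and alpha. *)
Definition U (p r : nat) (alpha : 'I_r -> nat) (m : nat)
    (p_pr : prime p) (m_gt0 : (0 < m)%N) : nat :=
  ex_minn (U_cond_ex alpha p_pr m_gt0).
Arguments U p {r} alpha m p_pr m_gt0.

(* Main.v *)
Require Import Defs.
From mathcomp Require Import all_boot all_order all_algebra.
From mathcomp Require Import boolp.

(** Let t be the bound U and suppose that a sequence of length t has no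
    subsequence S' with |S'| >= m and e_m(S') = 0.  Write f_i(X) for a natural
    number lifting the i-th coordinate of e_m of the subsequence on the set X
    of positions; f_i counts, with multiplicity, the m-subsets of X, so
    'C(f_i(X), k) is a multilinear polynomial of degree at most m k in the
    indicator of X.  Put q_i = p ^ alpha_i and
    g_i = \sum_(k < q_i) (-1)^k 'C(f_i, k), read modulo p.  Then g_i(X) = 1 if
    f_i(X) = 0, while g_i(X) = +- 'C(f_i(X) - 1, q_i - 1) = 0 if q_i does not
    divide f_i(X).  Hence \prod_i g_i is the indicator of |X| < m, and its
    degree is less than t, so its alternating sum over all X vanishes:
    \sum_(k < m) (-1)^k 'C(t, k) = 0 modulo p, contrary to the choice of t. *)

Set Implicit Arguments.
Unset Strict Implicit.
Unset Printing Implicit Defensive.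

Import GRing.Theory.

(** * Multilinear polynomials in the indicator of a set, and alternating sums *)

Section Degree.
Local Open Scope ring_scope.
Variables (R : comNzRingType) (T : finType).
Implicit Types (F G : {set T} -> R) (J X : {set T}) (d e : nat).

(* A pair (c, J) stands for the monomial c * \prod_(j in J) x_j evaluated at
   the indicator vector of X. *)
Definition deg_le d F : Prop :=
  exists2 s : seq (R * {set T}), all (fun u : R * {set T} => #|u.2| <= d)%N s &
    forall X, F X = \sum_(u <- s) u.1 *+ (u.2 \subset X).

Lemma deg_leW d e F : (d <= e)%N -> deg_le d F -> deg_le e F.
Proof.
move=> le_de [s /allP sd Fs]; exists s => //.
by apply/allP => u /sd; move/leq_trans; apply.
Qed.

Lemma deg_le_ext d F G : F =1 G -> deg_le d F -> deg_le d G.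
Proof. by move=> eqFG [s sd Fs]; exists s => // X; rewrite -eqFG. Qed.

Lemma deg_le_subset J : deg_le #|J| (fun X => (J \subset X)%:R).
Proof. by exists [:: (1, J)] => [|X]; rewrite /= ?leqnn // big_seq1. Qed.

Lemma deg_le_cst d c : deg_le d (fun=> c).
Proof.
by exists [:: (c, set0)] => [|X]; rewrite /= ?cards0 // big_seq1 sub0set.
Qed.

Lemma deg_leD d F G : deg_le d F -> deg_le d G -> deg_le d (fun X => F X + G X).
Proof.
move=> [s sd Fs] [s' s'd Gs']; exists (s ++ s') => [|X].
  by rewrite all_cat sd s'd.
by rewrite big_cat Fs Gs'.
Qed.

Lemma deg_leM d e F G :
  deg_le d F -> deg_le e G -> deg_le (d + e) (fun X => F X * G X).
Proof.
move=> [s /allP sd Fs] [s' /allP s'e Gs'].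
exists [seq (u.1 * v.1, u.2 :|: v.2) | u <- s, v <- s'] => [|X].
  apply/allP => _ /allpairsP[[u v] /= [/sd ud /s'e ve ->]] /=.
  by rewrite (leq_trans (leq_card_setU _ _)) // leq_add.
rewrite Fs Gs' big_distrlr big_allpairs_dep /=; apply: eq_bigr => u _.
apply: eq_bigr => v _; rewrite subUset mulrnAl mulrnAr -mulrnA.
by rewrite mulnC mulnb.
Qed.

Lemma deg_le_sum (I : Type) (r : seq I) (P : pred I) d (F : I -> {set T} -> R) :
  (forall i, P i -> deg_le d (F i)) ->
  deg_le d (fun X => \sum_(i <- r | P i) F i X).
Proof.
move=> Fd; elim: r => [|i r IHr].
  by apply: deg_le_ext (deg_le_cst d 0) => X; rewrite big_nil.
have [Pi|nPi] := boolP (P i); last first.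
  by apply: deg_le_ext IHr => X; rewrite big_cons (negPf nPi).
by apply: deg_le_ext (deg_leD (Fd i Pi) IHr) => X; rewrite big_cons Pi.
Qed.

Lemma deg_le_prod (I : Type) (r : seq I) (d : I -> nat)
    (F : I -> {set T} -> R) :
  (forall i, deg_le (d i) (F i)) ->
  deg_le (\sum_(i <- r) d i) (fun X => \prod_(i <- r) F i X).
Proof.
move=> Fd; elim: r => [|i r IHr].
  by apply: deg_le_ext (deg_le_cst _ 1) => X; rewrite big_nil.
rewrite big_cons.
by apply: deg_le_ext (deg_leM (Fd i) IHr) => X; rewrite big_cons.
Qed.

(** Pascal's rule, by induction on [s]: prepending [J] adds to 'C(c, n + 1) the indicator of
    [J \subset X], of degree at most [m], times 'C(c, n), where c is the old count. *)
Lemma deg_le_bin (s : seq {set T}) m n :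
  all (fun J : {set T} => #|J| <= m)%N s ->
  deg_le (m * n) (fun X => 'C(count (fun J : {set T} => J \subset X) s, n)%:R).
Proof.
elim: s n => [|J s IHs] n /=; first by move=> _; exact: deg_le_cst.
case/andP=> leJ {}/IHs IHs; case: n => [|n].
  by apply: deg_le_ext (deg_le_cst _ 1) => X; rewrite bin0.
apply: deg_le_ext (deg_leD (IHs n.+1) _) => [X|]; last first.
  rewrite mulnS; apply: deg_leM (IHs n).
  exact: deg_leW leJ (deg_le_subset J).
by case JX: (J \subset X); rewrite JX ?mul0r ?addr0 // mul1r add1n binS natrD.
Qed.

(** Adding or removing a fixed point outside [J] pairs the supersets of [J] with opposite signs. *)
Lemma sum_sign_superset J :
  (#|J| < #|T|)%N -> \sum_(X : {set T} | J \subset X) (-1) ^+ #|X| = 0 :> R.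
Proof.
move=> ltJ; have [x xJ] : exists x, x \notin J.
  apply/existsP; apply: contraLR ltJ => /existsPn inJ.
  rewrite -leqNgt subset_leq_card //; apply/subsetP => x _.
  by have := inJ x; rewrite negbK.
rewrite (bigID (fun X : {set T} => x \in X)) /=.
rewrite (reindex_onto (fun X => x |: X) (fun X => X :\ x)) /=; last first.
  by move=> X /andP[_ xX]; rewrite setD1K.
apply/eqP; rewrite addr_eq0 -sumrN; apply/eqP.
apply: eq_big => [X|X /andP[_ /eqP XE]]; last first.
  by rewrite cardsU1 -XE setD11 add1n exprS mulN1r.
rewrite setU11 andbT; have [xX|xX] := boolP (x \in X).
  rewrite andbF; apply/negbTE; apply: contraL xX => /andP[_ /eqP <-].
  by rewrite setD11.
rewrite setU1K // eqxx !andbT; apply/idP/idP; last first.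
  by move/subset_trans; apply; apply: subsetUr.
move=> /subsetP sJ; apply/subsetP => y yJ; have := sJ y yJ.
by case/setU1P=> // xy; rewrite -xy yJ in xJ.
Qed.

Lemma deg_le_sum_sign d F :
  deg_le d F -> (d < #|T|)%N -> \sum_(X : {set T}) (-1) ^+ #|X| * F X = 0.
Proof.
move=> [s /allP sd Fs] ltd; under eq_bigr do rewrite Fs mulr_sumr.
rewrite exchange_big big_seq big1 //= => u us.
transitivity (u.1 * \sum_(X : {set T} | u.2 \subset X) (-1) ^+ #|X|).
  rewrite mulr_sumr [RHS]big_mkcond; apply: eq_bigr => X _.
  by case: (_ \subset _); rewrite ?mulr0 // mulrC.
by rewrite sum_sign_superset ?mulr0 // (leq_ltn_trans (sd u us)).
Qed.

(** The sets are grouped by cardinality. *)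
Lemma sum_sign_card_lt m :
  \sum_(X : {set T} | (#|X| < m)%N) (-1) ^+ #|X| =
  \sum_(0 <= k < m) (-1) ^+ k * 'C(#|T|, k)%:R :> R.
Proof.
elim: m => [|m IHm]; first by rewrite big_geq // big_pred0.
rewrite big_nat_recr //= -IHm (bigID (fun X : {set T} => #|X| == m)) /= addrC.
congr (_ + _); first by apply: eq_bigl => X; rewrite ltnS andbC -ltn_neqAle.
rewrite (eq_big (fun X : {set T} => #|X| == m) (fun=> (-1) ^+ m)).
- by rewrite sumr_const -card_draws cardsE mulr_natr.
- by move=> X; rewrite ltnS andb_idl // => /eqP->.
by move=> X /andP[_ /eqP->].
Qed.

End Degree.

(** * Truncated alternating sums of binomial coefficients *)

Section TruncatedAlternatingSum.
Local Open Scope ring_scope.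
Variable R : comNzRingType.

Definition bin_alt (q n : nat) : R := \sum_(k < q) (-1) ^+ k * 'C(n, k)%:R.

Lemma bin_alt0 q : (0 < q)%N -> bin_alt q 0 = 1.
Proof.
case: q => // q _; rewrite /bin_alt big_ord_recl big1 ?addr0 ?mulr1 // => k _.
by rewrite mulr0.
Qed.

(** By Pascal's rule the sum telescopes. *)
Lemma bin_altS q n : bin_alt q.+1 n.+1 = (-1) ^+ q * 'C(n, q)%:R.
Proof.
rewrite /bin_alt; elim: q => [|q IHq]; first by rewrite big_ord1 !bin0.
rewrite big_ord_recr /= {}IHq binS natrD exprS mulN1r !mulNr mulrDr opprD.
by rewrite addrCA subrr addr0.
Qed.

(** With q = p ^ a, one has n 'C(n - 1, q - 1) = q 'C(n, q). Were 'C(n - 1, q - 1) prime to p, q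
    would divide n. *)
Lemma bin_alt_pchar p a n :
  p \in [pchar R] -> ~~ (p ^ a %| n)%N -> bin_alt (p ^ a) n = 0.
Proof.
move=> pR; have p_pr := pcharf_prime pR.
case: n => [|n ndiv]; first by rewrite dvdn0.
have q_gt0 : (0 < p ^ a)%N by rewrite expn_gt0 prime_gt0.
rewrite -(prednK q_gt0) bin_altS; suff -> : 'C(n, (p ^ a).-1)%:R = 0 :> R.
  by rewrite mulr0.
apply/eqP; rewrite -(dvdn_pcharf pR); apply: contraNT ndiv => pC.
have cop : coprime (p ^ a) 'C(n, (p ^ a).-1).
  by rewrite coprimeXl ?prime_coprime.
rewrite -(Gauss_dvdl _ cop); have := mul_bin_diag n.+1 (p ^ a).-1.
by rewrite /= prednK // => ->; apply: dvdn_mulr.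
Qed.

End TruncatedAlternatingSum.

Lemma natr_Fp_eq p m n : prime p -> (m%:R = n%:R :> 'F_p)%R -> m = n %[mod p].
Proof. by move=> p_pr /(congr1 val); rewrite /= !val_Fp_nat. Qed.

(** * Subsequences given by sets of positions, and their symmetric functions *)

Lemma map_nth_enum_subseq (E : eqType) (x0 : E) (S : seq E)
    (X : {set 'I_(size S)}) :
  subseq [seq nth x0 S i | i : 'I_(size S) in X] S.
Proof.
have enumK : [seq nth x0 S i | i : 'I_(size S)] = S.
  rewrite /image_mem (map_comp (nth x0 S) val) val_enum_ord.
  exact: mkseq_nth.
rewrite -[X in subseq _ X]enumK; apply: map_subseq.
by rewrite {1}/enum_mem [enum 'I_ _]enumT; exact: filter_subseq.
Qed.

Section ElementarySymmetric.
Local Open Scope ring_scope.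

Lemma elem_sym_image (A : comPzRingType) (T : finType) (f : T -> A)
    (X : {set T}) (m : nat) :
  elem_sym m [seq f i | i in X] =
  \sum_(J : {set T} | (J \subset X) && (#|J| == m)) \prod_(i in J) f i.
Proof.
have szX : size [seq f i | i in X] = #|X| by rewrite size_image.
pose e i := enum_val (cast_ord szX i).
have inj_e : injective e by move=> i j /enum_val_inj/cast_ord_inj.
(* The enumeration [e] of [X] matches sets of positions with subsets of [X], preserving
   cardinality. *)
rewrite [RHS](reindex_onto (fun I : {set _} => e @: I)
                           (fun J : {set T} => e @^-1: J)) /=.
  apply: eq_big => [I|I _].
    have -> : e @^-1: (e @: I) == I.
      by apply/eqP/setP => i; rewrite inE mem_imset.
    rewrite card_imset // andbT andb_idl // => _.
    by apply/subsetP => _ /imsetP[i _ ->]; exact: enum_valP.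
  rewrite big_imset /=; last by move=> i j _ _; exact: inj_e.
  by apply: eq_bigr => i _; exact: (nth_image 0 f (cast_ord szX i)).
move=> J /andP[/subsetP sJX _]; apply/setP => x; apply/imsetP/idP.
  by move=> [i + ->]; rewrite inE.
move=> xJ; exists (cast_ord (esym szX) (enum_rank_in (sJX x xJ) x)).
  by rewrite inE /e cast_ordKV enum_rankK_in ?sJX.
by rewrite /e cast_ordKV enum_rankK_in ?sJX.
Qed.

Lemma ring_prod_sumE (I : finType) (B : I -> finComPzRingType) (i : I)
    (K : Type) (s : seq K) (P : pred K) (F : K -> ring_prod B) :
  (\sum_(k <- s | P k) F k) i = \sum_(k <- s | P k) F k i.
Proof.
by apply: (big_morph (fun x : ring_prod B => x i)) => [x y|]; rewrite ffunE.
Qed.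

End ElementarySymmetric.

(** * Lifting symmetric functions over 'Z_q to natural numbers *)

Section Lift.
Local Open Scope ring_scope.
Variables (q : nat) (T : finType) (f : T -> 'Z_q) (m : nat).

(* Each m-subset J of T occurs as often as the canonical representative in
   [0, q) of the product over J. *)
Definition monomials : seq {set T} :=
  flatten [seq nseq (\prod_(i in J) f i)%R J
             | J : {set T} in [pred J : {set T} | #|J| == m]].

Lemma card_monomials J : J \in monomials -> #|J| = m.
Proof. by move=> /flatten_imageP[K /eqP Km /nseqP[->]]. Qed.

(** Casting a canonical representative back to 'Z_q recovers the product over [J]. *)
Lemma count_monomials (X : {set T}) : (1 < q)%N ->
  (count (fun J : {set T} => J \subset X) monomials)%:R
    = elem_sym m [seq f i | i in X].
Proof.
move=> q_gt1; rewrite elem_sym_image /monomials count_flatten sumnE big_map.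
rewrite /image_mem big_map big_enum /= natr_sum.
rewrite [RHS](eq_bigl _ _ (fun J => andbC _ _)) big_mkcondr /=.
apply: eq_bigr => J _; rewrite count_nseq natrM natr_Zp.
by case: ifP; rewrite ?mul1r ?mul0r.
Qed.

Lemma dvdn_count_monomials (X : {set T}) : (1 < q)%N ->
  (q %| count (fun J : {set T} => J \subset X) monomials)%N
    = (elem_sym m [seq f i | i in X] == 0).
Proof.
move=> q_gt1; rewrite -count_monomials //.
by rewrite -(inj_eq val_inj) /= val_Zp_nat //.
Qed.

Lemma count_monomials_small (X : {set T}) :
  (#|X| < m)%N -> count (fun J : {set T} => J \subset X) monomials = 0%N.
Proof.
move=> ltX; apply/eqP; rewrite eqn0Ngt -has_count.
apply/hasPn => J /card_monomials Jm.
by apply: contraL ltX => /subset_leq_card; rewrite Jm -leqNgt.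
Qed.

End Lift.

(** * The vanishing subsequence and the bound *)

Section MainBound.
Local Open Scope ring_scope.
Variables (p r : nat) (alpha : 'I_r -> nat) (m : nat).
Hypotheses (p_pr : prime p) (alpha_gt0 : forall i, (0 < alpha i)%N).
Let q i := (p ^ alpha i)%N.
Let A := ring_prod (fun i => 'Z_(q i)).

Lemma exists_elem_sym_eq0 (T : finType) (f : T -> A) :
  (m * (\sum_(i < r) (q i - 1)) < #|T|)%N ->
  \sum_(0 <= k < m) (-1) ^+ k * 'C(#|T|, k)%:R != 0 :> 'F_p ->
  exists2 X : {set T}, (m <= #|X|)%N & elem_sym m [seq f i | i in X] = 0.
Proof.
move=> ltT sum_neq0.
have q_gt1 i : (1 < q i)%N.
  by rewrite -(exp1n (alpha i)) ltn_exp2r ?prime_gt1.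
pose c i (X : {set T}) :=
  count (fun J : {set T} => J \subset X) (monomials (fun j => f j i) m).
pose F (X : {set T}) : 'F_p := \prod_(i < r) bin_alt 'F_p (q i) (c i X).
have degF : deg_le (m * (\sum_(i < r) (q i - 1))) F.
  rewrite big_distrr /=; apply: deg_le_prod => i; apply: deg_le_sum => k _.
  (* The sum stops at k = q_i - 1, which caps the degree of the i-th factor. *)
  have lek : (m * k <= m * (q i - 1))%N.
    by rewrite leq_mul2l -ltnS subn1 prednK ?ltn_ord ?orbT // ltnW.
  rewrite -[X in deg_le X]add0n; apply: deg_leM; first exact: deg_le_cst.
  apply: deg_leW lek (deg_le_bin _ _ _).
  by apply/allP => J /card_monomials ->.
have F1 (X : {set T}) : (#|X| < m)%N -> F X = 1.
  move=> ltX; rewrite /F big1 // => i _.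
  by rewrite /c count_monomials_small // bin_alt0 // ltnW.
apply: contrapT => no.
(* The zero on the right becomes the alternating sum of [F] over all sets, to be cut down to those
   with fewer than [m] elements. *)
case/eqP: sum_neq0; rewrite -sum_sign_card_lt -[RHS](deg_le_sum_sign degF ltT).
rewrite [RHS](bigID (fun X : {set T} => (#|X| < m)%N)) /=.
rewrite [X in _ + X]big1 ?addr0 => [|X]; last first.
  rewrite -leqNgt => leX; have /existsP[i i_neq0] :
      [exists i, elem_sym m [seq f j i | j in X] != 0].
    apply: contra_notT no => /existsPn eq0; exists X => //.
    apply/ffunP => i; move/(_ i)/negbNE/eqP: eq0; rewrite !elem_sym_image.
    rewrite ring_prod_sumE ffunE => eq0i; rewrite -[RHS]eq0i.
    apply: eq_bigr => J _.
    by apply: (big_morph (fun x : A => x i)) => [x y|]; rewrite ffunE.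
  (* A nonzero i-th coordinate means that q_i does not divide [c i X], so the i-th factor is 0. *)
  rewrite /F (bigD1 i) //= bin_alt_pchar ?mul0r ?mulr0 ?pchar_Fp //.
  by rewrite dvdn_count_monomials ?(q_gt1 i).
by apply: eq_bigr => X ltX; rewrite F1 ?mulr1.
Qed.

End MainBound.

(** In 'F_p the signed sum is the even-index sum minus the odd-index one. *)
Lemma U_cond_sum_neq0 (p r : nat) (alpha : 'I_r -> nat) (m t : nat) :
  prime p -> U_cond p alpha m t ->
  (\sum_(0 <= k < m) (-1) ^+ k * 'C(t, k)%:R != 0 :> 'F_p)%R.
Proof.
move=> p_pr /andP[_]; apply: contra => /eqP.
rewrite (bigID odd) /= addrC => sum0; apply/eqP/(natr_Fp_eq p_pr).
rewrite !natr_sum; apply/eqP; rewrite -subr_eq0 -sumrN -[eqbRHS]sum0.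
apply/eqP; congr (_ + _)%R; apply: eq_bigr => k okk; rewrite -signr_odd.
  by rewrite (negPf okk) mul1r.
by rewrite okk mulN1r.
Qed.

Theorem theorem9 (p r : nat) (alpha : 'I_r -> nat) (m : nat)
    (p_pr : prime p) (r_gt0 : (0 < r)%N)
    (alpha_gt0 : forall i : 'I_r, (0 < alpha i)%N) (m_gt0 : (0 < m)%N) :
  (Dm (ring_prod (fun i : 'I_r => 'Z_(p ^ alpha i))) m m_gt0
     <= U p alpha m p_pr m_gt0)%N.
Proof.
rewrite /Dm /U; case: ex_minnP => d _ d_min; case: ex_minnP => t Ut _.
apply: d_min; apply/asboolP; have /andP[lt_t _] := Ut; rewrite addn1 in lt_t.
split=> [|S leS]; first exact: leq_ltn_trans lt_t.
(* The binomial condition concerns [t] itself, so a longer sequence is truncated to length exactly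
   [t]. *)
pose S0 := take t S; have szS0 : size S0 = t by rewrite size_takel.
have [||X leX X0] := @exists_elem_sym_eq0 p r alpha m p_pr alpha_gt0
  'I_(size S0) (fun j => nth 0%R S0 j).
- by rewrite card_ord szS0.
- by rewrite card_ord szS0; exact: U_cond_sum_neq0 Ut.
exists [seq nth 0%R S0 j | j : 'I_(size S0) in X]; split=> //.
  exact: subseq_trans (map_nth_enum_subseq _ X) (take_subseq _ _).
by rewrite size_image.
Qed.
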